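(* Let $q=p^f$ be a prime power and $N>2$ an integer with $N\mid(q-1)$. Let $\gamma$ be a primitive element of $\mathbb{F}_q$, $C_i=\gamma^i\langle\gamma^N\rangle$ for $0\le i\le N-1$, and $\eta_a=\sum_{x\in C_a}\psi(x)$. Assume that $-1\in C_0$ and that the $\eta_a$, $0\le a\le N-1$, take exactly three rational values $\alpha_1,\alpha_2,\alpha_3$ with $\alpha_1-\alpha_2=-tu<0$ and $\alpha_3-\alpha_2=tv>0$, $t>0$. For $i=1,2,3$ let $I_i=\{a\in\mathbb{Z}_N:\eta_a=\alpha_i\}$, and set $R_0=\{0\}$, $R_i=\bigcup_{j\in I_i}C_j$ for $i=1,2,3$. For $0\le i\le 3$ define $\mathcal{R}_i=\{(x,y)\in\mathbb{F}_q\times\mathbb{F}_q: x-y\in R_i\}$. If $|I_1|=1$ or $|I_3|=1$, then $(\mathbb{F}_q,\{\mathcal{R}_i\}_{i=0}^3)$ is a self-dual three-class association scheme.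
   Context: $\psi$ is the canonical additive character of $\mathbb{F}_q$: $\psi(x)=\xi_p^{\mathrm{Tr}_{q/p}(x)}$. A (symmetric) association scheme with $d$ classes on a finite set $X$ is a partition of $X\times X$ into $R_0,\dots,R_d$ with $R_0$ the diagonal, each $R_i$ symmetric, and such that for all $i,j,k$ the number of $z$ with $(x,z)\in R_i$, $(z,y)\in R_j$ depends only on $i,j,k$ for $(x,y)\in R_k$. If $X$ is an abelian group and $R_i=\{(x,x+y):y\in D_i\}$ for a partition $D_0=\{0\},D_1,\dots,D_d$ of $X$, the scheme is a translation scheme; its dual is the translation scheme on the character group $\widehat X$ whose classes $D_0',\dots,D_d'$ are the equivalence classes of $\chi\sim\chi'$ iff $\chi(D_i)=\chi'(D_i)$ for all $i$. The scheme is self-dual if it is isomorphic to its dual. *)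

(* Defs.v *)
From HB Require Import structures.
From mathcomp Require Import all_boot all_order all_algebra all_fingroup all_field.
Set Implicit Arguments. Unset Strict Implicit. Unset Printing Implicit Defensive.
Import Order.TTheory GRing.Theory Num.Theory.
Local Open Scope ring_scope.

Section FiniteField.
Variable F : finFieldType.

Definition fchar : nat := pdiv #|F|.
Definition fdeg : nat := logn fchar #|F|.

Definition abs_trace (x : F) : F := \sum_(i < fdeg) x ^+ (fchar ^ i).

Definition trace_index (x : F) : nat :=
  odflt 0%N (omap val [pick k : 'I_fchar | (k%:R : F) == abs_trace x]).

(* xi_p = exp(2 pi i / p): square of p.-root(-1) = exp(i pi / p) *)
Definition xi_p : algC := (fchar.-root (-1)) ^+ 2.

Definition psi (x : F) : algC := xi_p ^+ trace_index x.

Definition cyc_class (gamma : F) (N i : nat) : {set F} :=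
  [set gamma ^+ (N * k + i)%N | k : 'I_#|F|].

Definition gauss_period (gamma : F) (N a : nat) : algC :=
  \sum_(x in cyc_class gamma N a) psi x.

Definition period_index_set (gamma : F) (N : nat) (alpha : rat) : {set 'I_N} :=
  [set a : 'I_N | gauss_period gamma N a == ratr alpha].

Definition period_union (gamma : F) (N : nat) (alpha : rat) : {set F} :=
  \bigcup_(j in period_index_set gamma N alpha) cyc_class gamma N j.

Definition gp_partition (gamma : F) (N : nat) (a1 a2 a3 : rat) (i : 'I_4) : {set F} :=
  match val i with
  | 0%N => [set 0]
  | 1%N => period_union gamma N a1
  | 2%N => period_union gamma N a2
  | _ => period_union gamma N a3
  end.

End FiniteField.

Definition is_assoc_scheme (X : finType) (d : nat) (R : 'I_d.+1 -> rel X) : Prop :=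
  [/\
      (forall x y, #|[set i | R i x y]| = 1%N),
      (forall i, exists x y, R i x y),
      (forall x y, R ord0 x y = (x == y)),
      (forall i x y, R i x y = R i y x) &
      (forall i j k x y x' y', R k x y -> R k x' y' ->
         #|[set z | R i x z && R j z y]| = #|[set z | R i x' z && R j z y']|)].

Definition translation_rel (G : finZmodType) (d : nat) (D : 'I_d.+1 -> {set G})
  (i : 'I_d.+1) : rel G := fun x y => (x - y) \in D i.

Definition additive_char (G : finZmodType) (chi : G -> algC) : Prop :=
  chi 0 = 1 /\ forall x y, chi (x + y) = chi x * chi y.

Definition dual_equiv (G : finZmodType) (d : nat) (D : 'I_d.+1 -> {set G})
  (chi chi' : G -> algC) : Prop :=
  forall i, \sum_(y in D i) chi y = \sum_(y in D i) chi' y.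

(* The translation scheme given by D is isomorphic to its dual: there is a
   bijection b |-> Phi b from G onto the character group of G carrying the
   partition {(x,y) : x - y in D_i} of G x G onto the partition of the dual
   scheme {(chi,chi') : chi chi'^{-1} in D'_j}, D'_j being the ~-classes. *)
Definition self_dual_translation (G : finZmodType) (d : nat)
  (D : 'I_d.+1 -> {set G}) : Prop :=
  exists Phi : G -> G -> algC,
    [/\ (forall b, additive_char (Phi b)),
        (forall chi, additive_char chi -> exists b, forall x, Phi b x = chi x),
        (forall b b', (forall x, Phi b x = Phi b' x) -> b = b') &
        (forall x y x' y',
           (forall i, ((x - y) \in D i) = ((x' - y') \in D i)) <->
           dual_equiv D (fun z => Phi x z / Phi y z)
                        (fun z => Phi x' z / Phi y' z))].

(* Main.v *)
(** Let k = |C_0|, let eta(b) = sum_{x in C_0} psi(b x), and say that |I_1| = 1,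
    so that R_1 = C_i; put w = gamma^-i and pair b with the character
    x |-> psi(w b x).  Its sum over R_1 is eta(b).  Since -1 is in C_0,
    orthogonality gives, for b <> 0,
      sum_{y <> 0} eta(y) psi(w b y) = q [b in R_1] - k,
    where the left-hand side is the combination of the sums over R_1, R_2, R_3
    with weights alpha_1, alpha_2, alpha_3.  As these three sums add up to -1 and
    alpha_3 <> alpha_2, all of them are functions of eta(b).  So the map from b to
    its character carries the partition {R_i} onto its dual, and as the pairing is
    symmetric in b and x, Fourier inversion shows that the intersection numbers
    are well defined.  The case |I_3| = 1 follows by exchanging alpha_1 and
    alpha_3. *)
Require Import Defs.
From HB Require Import structures.
From mathcomp Require Import all_boot all_order all_algebra all_fingroup all_field ring.
Import Order.TTheory GRing.Theory Num.Theory.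
Local Open Scope ring_scope.

Set Implicit Arguments. Unset Strict Implicit. Unset Printing Implicit Defensive.

(** * Roots of unity of prime order and the prime field *)

Lemma prime_primitive_root (R : nzRingType) (p : nat) (z : R) :
  prime p -> z ^+ p = 1 -> z != 1 -> p.-primitive_root z.
Proof.
move=> p_pr zp1 z_neq1.
have [m prim_z m_dv] := prim_order_exists (prime_gt0 p_pr) zp1.
case/primeP: p_pr => _ /(_ m m_dv) /orP[] /eqP mE; last by rewrite -mE.
by move: (prim_expr_order prim_z) z_neq1; rewrite mE expr1 => ->; rewrite eqxx.
Qed.

Lemma natr_eq_mod_pchar (R : nzRingType) (p : nat) (chRp : p \in [pchar R])
  (i j : nat) : (i%:R == j%:R :> R) = (i == j %[mod p]).
Proof.
wlog le_ji : i j / (j <= i)%N => [IH|].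
  have [/IH // | /ltnW /IH] := leqP j i; by rewrite eq_sym => ->; rewrite eq_sym.
by rewrite eqn_mod_dvd // (dvdn_pcharf chRp) natrB // subr_eq0.
Qed.

(** The [p] natural multiples of 1 are already roots of ['X^p - 'X]; a fixed point outside them
    would be root number [p + 1]. *)
Lemma pFrobenius_fixed_nat (F : fieldType) (p : nat) (chFp : p \in [pchar F])
  (x : F) : x ^+ p = x -> exists k : 'I_p, (k%:R : F) = x.
Proof.
move=> xp; have p_pr := pcharf_prime chFp; have p_gt1 := prime_gt1 p_pr.
pose P : {poly F} := 'X^p - 'X.
have sP : size P = p.+1.
  by rewrite size_polyDl size_polyXn // size_polyN size_polyX.
have P_neq0 : P != 0 by rewrite -size_poly_eq0 sP.
pose rs := [seq ((k : nat)%:R : F) | k : 'I_p].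
have rs_uniq : uniq rs.
  rewrite map_inj_uniq ?enum_uniq // => i j /eqP.
  by by rewrite (natr_eq_mod_pchar chFp) !modn_small // => /eqP/val_inj.
have [/imageP[k _ ->] | xrs] := boolP (x \in rs); first by exists k.
have /= := max_poly_roots P_neq0 (rs := x :: rs).
rewrite xrs rs_uniq rootE !hornerE xp subrr eqxx sP size_image card_ord ltnn.
move=> H; suff: false by []; apply: H => //; apply/allP=> y /imageP[k _ ->].
by rewrite rootE !hornerE -(pFrobenius_autE chFp) pFrobenius_aut_nat subrr.
Qed.

(** * The trace and the canonical additive character *)

Section CanonicalCharacter.
Variable F : finFieldType.
Local Notation p := (fchar F).
Local Notation f := (fdeg F).

Lemma fchar_pchar : p \in [pchar F].
Proof.
have [p' p'_pr chFp'] := finPcharP F.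
have cF : #|F| = (p' ^ logn p' #|F|)%N by exact: (card_pprimeChar chFp').
move: cF; case: (logn _ _) => [|n] cF.
  by have := finNzRing_gt1 F; rewrite cF.
by rewrite /fchar cF pdiv_pfactor.
Qed.

Lemma fchar_prime : prime p.
Proof. exact: pcharf_prime fchar_pchar. Qed.

Lemma card_fchar_fdeg : #|F| = (p ^ f)%N.
Proof. exact: (card_pprimeChar fchar_pchar). Qed.

Lemma fdeg_gt0 : (0 < f)%N.
Proof. by have := finNzRing_gt1 F; rewrite card_fchar_fdeg; case: f. Qed.

Lemma pchar_nat_fcharX n : [pchar F].-nat (p ^ n)%N.
Proof. by rewrite pnatX pnatE ?fchar_prime // fchar_pchar. Qed.

Lemma abs_traceD : {morph @abs_trace F : x y / x + y}.
Proof.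
move=> x y; rewrite /abs_trace -big_split; apply: eq_bigr => i _.
exact/exprDn_pchar/pchar_nat_fcharX.
Qed.

(** Frobenius permutes the summands cyclically: the last one becomes [x ^+ #|F| = x], which is the
    first. *)
Lemma abs_trace_Frobenius (x : F) : abs_trace x ^+ p = abs_trace x.
Proof.
rewrite -(pFrobenius_autE fchar_pchar) /abs_trace rmorph_sum /=.
have := fdeg_gt0; have := card_fchar_fdeg.
case: (f) => // n cF _; rewrite big_ord_recr big_ord_recl /= addrC.
congr (_ + _); first by rewrite pFrobenius_autE -exprM -expnSr -cF expf_card.
by apply: eq_bigr => i _; rewrite pFrobenius_autE -exprM -expnSr.
Qed.

(** The default value in [trace_index] is never reached: the trace is fixed by Frobenius, hence lies
    in the prime field. *)
Lemma trace_index_natr (x : F) : (trace_index x)%:R = abs_trace x.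
Proof.
rewrite /trace_index; case: pickP => [k /eqP // | no].
have [k kE] := pFrobenius_fixed_nat fchar_pchar (abs_trace_Frobenius x).
by have := no k; rewrite kE eqxx.
Qed.

(** The trace is a polynomial function of degree less than [#|F|], and its polynomial is nonzero
    because the coefficient of ['X] is 1; so it cannot vanish on all of [F]. *)
Lemma abs_trace_neq0 : exists x : F, abs_trace x != 0.
Proof.
pose P : {poly F} := \sum_(i < f) 'X^(p ^ i).
have p_gt1 := prime_gt1 fchar_prime.
have P_neq0 : P != 0.
  apply/eqP => /(congr1 (fun Q : {poly F} => Q`_1)); apply/eqP.
  rewrite coef_sum coef0; have := fdeg_gt0; case: (f) => // n _.
  rewrite big_ord_recl coefXn big1 ?addr0 ?oner_neq0 // => i _.
  by rewrite coefXn ltn_eqF // -(expn0 p) ltn_exp2l.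
have sP : (size P <= #|F|)%N.
  apply: leq_trans (size_sum _ _ _) _; apply/bigmax_leqP => i _.
  by rewrite size_polyXn card_fchar_fdeg ltn_exp2l.
have [x Px] : exists x, ~~ root P x.
  apply/existsP; rewrite -negb_forall; apply/negP => /forallP allP0.
  have := max_poly_roots P_neq0 (rs := enum F) _ (enum_uniq _).
  rewrite -cardE ltnNge sP => H; suff: false by []; apply: H.
  by apply/allP => x _; apply: allP0.
exists x; move: Px; rewrite rootE horner_sum; congr (_ != 0).
by apply: eq_bigr => i _; rewrite !hornerE.
Qed.

Lemma xi_p_primitive : p.-primitive_root (xi_p F).
Proof.
have p_pr := fchar_prime; have p_gt1 := prime_gt1 p_pr.
have rK : (p.-root (-1) : algC) ^+ p = -1 by rewrite rootCK // prime_gt0.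
have N1 : (1 : algC) <> -1 by move=> N1; have := ltrN10 algC; rewrite -N1 ltr10.
apply: prime_primitive_root => //; first by rewrite /xi_p exprAC rK sqrrN expr1n.
(* If the square of the root were 1, then for [p = 2] this square would also be -1. For odd [p] the
   root would be 1, whose [p]-th power is not -1, or -1, whereas [p.-root] never returns a negative
   number. *)
apply/negP => /eqP r2; have [p2 | p_odd] := even_prime p_pr.
  by move: rK; rewrite [X in _ ^+ X]p2 -/(xi_p F) r2.
move/eqP: r2; rewrite /xi_p sqrf_eq1 => /orP[] /eqP rE.
  by move: rK; rewrite rE expr1n.
by have := rootC_lt0 (-1 : algC) p_gt1; rewrite rE ltrN10.
Qed.

Lemma psi_additive_char : additive_char (@psi F).
Proof.
split.
  apply/eqP; rewrite /psi -(prim_order_dvd xi_p_primitive).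
  rewrite (dvdn_pcharf fchar_pchar) trace_index_natr.
  by apply/eqP/(addrI (abs_trace 0)); rewrite -abs_traceD !addr0.
move=> x y; rewrite /psi -exprD; apply/eqP.
rewrite (eq_prim_root_expr xi_p_primitive) -(natr_eq_mod_pchar fchar_pchar).
by rewrite natrD !trace_index_natr abs_traceD.
Qed.

Lemma psi_nontrivial : exists x : F, psi x != 1.
Proof.
have [x tx] := abs_trace_neq0; exists x.
by rewrite /psi -(prim_order_dvd xi_p_primitive) (dvdn_pcharf fchar_pchar)
           trace_index_natr.
Qed.

End CanonicalCharacter.

(** * Orthogonality of additive characters *)

Section AdditiveCharacters.
Variable G : finZmodType.

Lemma additive_char_neq0 (chi : G -> algC) x : additive_char chi -> chi x != 0.
Proof.
case=> chi0 chiD; apply/eqP => chix; move/eqP: chi0.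
by rewrite -(subrr x) chiD chix mul0r eq_sym oner_eq0.
Qed.

Lemma additive_charN (chi : G -> algC) x :
  additive_char chi -> chi (- x) = (chi x)^-1.
Proof.
move=> chiP; case: (chiP) => chi0 chiD.
by apply: (mulfI (additive_char_neq0 x chiP)); rewrite -chiD subrr chi0
  divff ?additive_char_neq0.
Qed.

(** Translating the summation variable by [a] multiplies the sum by [chi a]. *)
Lemma sum_additive_char (chi : G -> algC) a :
  additive_char chi -> chi a != 1 -> \sum_x chi x = 0.
Proof.
case=> _ chiD chia; apply/eqP; have: (chi a - 1) * (\sum_x chi x) == 0.
  rewrite mulrBl mul1r subr_eq0; apply/eqP.
  rewrite mulr_sumr [RHS](reindex_inj (addrI a)).
  by apply: eq_bigr => x _; rewrite chiD.
by rewrite mulf_eq0 subr_eq0 (negPf chia).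
Qed.

(** * Symmetric nondegenerate pairings, which identify a group with its dual *)

Variable Phi : G -> G -> algC.
Hypothesis PhiC : forall x y, Phi x y = Phi y x.
Hypothesis Phi_char : forall b, additive_char (Phi b).
Hypothesis Phi_nondeg : forall b, b != 0 -> exists x, Phi b x != 1.

Lemma pairing_sum b : \sum_x Phi b x = if b == 0 then #|G|%:R else 0.
Proof.
have [-> | /Phi_nondeg [a Pa]] := eqVneq b 0; last first.
  exact: sum_additive_char (Phi_char b) Pa.
under eq_bigr do rewrite PhiC (Phi_char _).1.
by rewrite sumr_const.
Qed.

Lemma pairingDl b c x : Phi (b + c) x = Phi b x * Phi c x.
Proof. by rewrite !(PhiC _ x) (Phi_char x).2. Qed.

Lemma pairingNl b x : Phi (- b) x = (Phi b x)^-1.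
Proof. by rewrite !(PhiC _ x) additive_charN. Qed.

Lemma pairing_inj b b' : (forall x, Phi b x = Phi b' x) -> b = b'.
Proof.
move=> bb'; apply/eqP; rewrite -subr_eq0; apply/negPn/negP.
case/Phi_nondeg=> x; rewrite pairingDl pairingNl bb' divff ?eqxx //.
exact: additive_char_neq0.
Qed.

Lemma card_neq0 : #|G|%:R != 0 :> algC.
Proof. by rewrite pnatr_eq0 -lt0n; apply/card_gt0P; exists 0. Qed.

(* A character orthogonal to every [Phi b] would vanish at [0] by Fourier inversion. *)
Lemma pairing_surj (chi : G -> algC) :
  additive_char chi -> exists b, forall x, Phi b x = chi x.
Proof.
move=> chiP.
have [/existsP[b /forallP bP] | /existsPn noP] :=
    boolP [exists b, forall x, Phi b x == chi x].
  by exists b => x; apply/eqP.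
have S0 b : \sum_x chi x * Phi (- b) x = 0.
  have /forallPn[a Pa] := noP b.
  apply: (@sum_additive_char _ a).
    split=> [|x y]; first by rewrite chiP.1 (Phi_char _).1 mulr1.
    by rewrite chiP.2 (Phi_char _).2 mulrACA.
  apply: contra Pa => /eqP H; apply/eqP; move: H; rewrite pairingNl => H.
  by rewrite -[LHS]mul1r -H divfK // additive_char_neq0.
have : \sum_b \sum_x chi x * Phi (- b) x = #|G|%:R.
  rewrite exchange_big (bigD1 0) //= [X in _ + X]big1 => [|x x0]; last first.
    rewrite -mulr_sumr (reindex_inj oppr_inj) /=.
    under eq_bigr do rewrite opprK PhiC.
    by rewrite pairing_sum (negPf x0) mulr0.
  under eq_bigr do rewrite chiP.1 (Phi_char _).1 mulr1.
  by rewrite sumr_const addr0.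
rewrite big1 => [/esym /eqP|b _]; last exact: S0.
by rewrite (negPf card_neq0).
Qed.

(** Expand the right-hand side over [s] in [A] and [r] in [B]. Summing over [b] first leaves [#|G|]
    exactly when [s + r = x - y], and such pairs are [s = x - z], [r = z - y]. *)
Lemma pairing_intersection_number (A B : {set G}) (x y : G) :
  #|[set z | (x - z \in A) && (z - y \in B)]|%:R * #|G|%:R =
  \sum_b (\sum_(s in A) Phi b s) * (\sum_(s in B) Phi b s) * Phi b (y - x).
Proof.
transitivity (\sum_(s in A) \sum_(r in B) \sum_b Phi b (s + r + (y - x))).
  have addE s r : (s + r + (y - x) == 0) = (r == x - y - s).
    by rewrite -(opprB x y) subr_eq0 [LHS]eq_sym (addrC s) -subr_eq eq_sym.
  transitivity (\sum_(s in A) if x - y - s \in B then #|G|%:R else 0 : algC).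
    rewrite -sum1_card natr_sum mulr_suml -!big_mkcondr.
    rewrite [RHS](reindex_inj (subrI x)) /=; apply: eq_big => z.
      have -> : x - y - (x - z) = z - y by rewrite opprB addrC addrA subrK.
      by rewrite inE.
    by rewrite mul1r.
  apply: eq_bigr => s _; rewrite big_mkcond /=.
  under eq_bigr => r _ do under eq_bigr do rewrite PhiC.
  under eq_bigr => r _ do rewrite pairing_sum addE.
  rewrite (bigD1 (x - y - s)) //= eqxx big1 ?addr0 // => r /negPf ->.
  by rewrite if_same.
under eq_bigr do rewrite exchange_big.
rewrite exchange_big /=; apply: eq_bigr => b _.
rewrite mulrAC -mulrA mulr_suml; apply: eq_bigr => s _.
rewrite mulrA mulr_sumr; apply: eq_bigr => r _.
by rewrite !(Phi_char b).2 mulrAC.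
Qed.

(** The last hypothesis says that [b |-> Phi b] carries the partition by [cls] onto the dual
    partition. It serves both conclusions: it makes the Fourier coefficients of the classes constant
    on classes, and it makes the pairing itself the isomorphism. *)
Theorem pairing_scheme_self_dual (d : nat) (D : 'I_d.+1 -> {set G})
    (cls : G -> 'I_d.+1) :
  (forall i x, (x \in D i) = (cls x == i)) ->
  (forall i, exists x, cls x = i) ->
  (forall x, (cls x == ord0) = (x == 0)) ->
  (forall x, cls (- x) = cls x) ->
  (forall b b', cls b = cls b' <->
     forall i, \sum_(x in D i) Phi b x = \sum_(x in D i) Phi b' x) ->
  is_assoc_scheme (translation_rel D) /\ self_dual_translation D.
Proof.
move=> DE cls_onto cls0 clsN clsP; split.
  split.
  - move=> x y; rewrite -(cards1 (cls (x - y))); apply: eq_card => i.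
    by rewrite !inE /translation_rel DE eq_sym.
  - move=> i; have [x xi] := cls_onto i; exists x, 0.
    by rewrite /translation_rel DE subr0 xi.
  - by move=> x y; rewrite /translation_rel DE cls0 subr_eq0.
  - by move=> i x y; rewrite /translation_rel !DE -opprB clsN.
  move=> i j k x y x' y'; rewrite /translation_rel !DE -opprB clsN => /eqP xy.
  rewrite -[x' - y']opprB clsN -{}xy => /eqP xy.
  apply/eqP; rewrite -(eqr_nat algC); apply/eqP; apply: (mulIf card_neq0).
  rewrite !pairing_intersection_number.
  rewrite !(partition_big cls xpredT) //=; apply: eq_bigr => m _.
  have [r rm] := cls_onto m.
  pose P i := \sum_(s in D i) Phi r s.
  (* On the class [m] the two coefficients are constant; by symmetry of [Phi] what remains is a
     character sum of [Phi w] over a class, which depends on [w] only through [cls w]. *)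
  have sumE w : \sum_(b | cls b == m) (\sum_(s in D i) Phi b s) *
      (\sum_(s in D j) Phi b s) * Phi b w = P i * P j * \sum_(b in D m) Phi w b.
    rewrite mulr_sumr; apply: eq_big => [b|b /eqP bm]; first by rewrite DE.
    have /clsP bP : cls b = cls r by rewrite bm.
    by rewrite !bP PhiC.
  by rewrite !sumE (iffLR (clsP _ _) xy).
(* The quotient of [Phi x] by [Phi y] is [Phi (x - y)], so the last clause reduces to [clsP] at the
   differences. *)
exists Phi; split; [exact: Phi_char | exact: pairing_surj | exact: pairing_inj |].
move=> x y x' y'.
have sumE b c i :
    \sum_(z in D i) Phi b z / Phi c z = \sum_(z in D i) Phi (b - c) z.
  by apply: eq_bigr => z _; rewrite pairingDl pairingNl.
split=> [clsE i|dualE].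
  rewrite !sumE; apply: (iffLR (clsP _ _)) => //; apply/esym/eqP.
  by rewrite -DE -clsE DE.
have /clsP xy : forall i, \sum_(z in D i) Phi (x - y) z =
    \sum_(z in D i) Phi (x' - y') z by move=> i; rewrite -!sumE.
by move=> i; rewrite !DE xy.
Qed.

End AdditiveCharacters.

(** * Cyclotomic classes and Gauss periods *)

Section GaussPeriods.
Variables (F : finFieldType) (N : nat) (gamma : F).
Hypothesis N_gt0 : (0 < N)%N.
Hypothesis N_dvd : (N %| #|F|.-1)%N.
Hypothesis gamma_prim : (#|F|.-1).-primitive_root gamma.

Local Notation C := (cyc_class gamma N).
Local Notation K := (#|F|.-1 %/ N)%N.

(** The period as a function on all of [F], so that its Fourier transform makes sense; its value at
    0 is [#|C 0|]. *)
Definition cyc_period (b : F) : algC := \sum_(x in C 0) psi (b * x).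

Lemma gamma_neq0 : gamma != 0.
Proof.
have := oner_neq0 F; rewrite -(prim_expr_order gamma_prim) expf_eq0.
by rewrite (prim_order_gt0 gamma_prim).
Qed.

Lemma exponent_gt0 : (0 < K)%N.
Proof.
by rewrite divn_gt0 // dvdn_leq // (prim_order_gt0 gamma_prim).
Qed.

Lemma primitive_log (y : F) : y != 0 -> exists m : 'I_(#|F|.-1), y = gamma ^+ m.
Proof.
move=> y0; have [|m] := prim_rootP gamma_prim (x := y); last by exists m.
apply: (mulfI y0); rewrite -exprS mulr1 prednK ?expf_card //.
exact: ltnW (finNzRing_gt1 F).
Qed.

Lemma modn_mul_exponent (m : nat) : (m * K %% #|F|.-1 = K * (m %% N))%N.
Proof. by rewrite -[X in (_ %% X)%N](divnK N_dvd) (mulnC m) muln_modr. Qed.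

(** Raising to the power [K] kills the powers of [gamma ^+ N] and sends distinct classes to distinct
    powers of [gamma ^+ K]. This turns membership into an equation that is compatible with
    products. *)
Lemma mem_cyc_class (i : nat) (y : F) :
  (i < N)%N -> (y \in C i) = (y ^+ K == gamma ^+ (i * K)).
Proof.
move=> iN; apply/imsetP/eqP => [[k _ ->] | yK].
  rewrite exprD exprMn -!exprM mulnAC (mulnC N) divnK //.
  by rewrite exprM (prim_expr_order gamma_prim) expr1n mul1r.
have y0 : y != 0.
  apply/eqP => y0; move/eqP: yK; rewrite y0 expr0n gtn_eqF ?exponent_gt0 //.
  by rewrite eq_sym expf_eq0 (negPf gamma_neq0) andbF.
have [m yE] := primitive_log y0.
have mN : (m %% N)%N = i.
  move/eqP: yK; rewrite yE -exprM (eq_prim_root_expr gamma_prim).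
  by rewrite !modn_mul_exponent eqn_pmul2l ?exponent_gt0 // (modn_small iN) => /eqP.
(* The exponents in [cyc_class] range over all [k] below [#|F|], which leaves room for the quotient
   [m %/ N]. *)
have mF : (m %/ N < #|F|)%N.
  apply: leq_ltn_trans (leq_div _ _) _.
  by apply: leq_trans (ltn_ord m) _; rewrite leq_pred.
by exists (Ordinal mF); rewrite //= mulnC -mN -divn_eq.
Qed.

Lemma mem_cyc_class0 (y : F) : (y \in C 0) = (y ^+ K == 1).
Proof. by rewrite mem_cyc_class // mul0n expr0. Qed.

Lemma cyc_class_neq0 (i : nat) (y : F) : y \in C i -> y != 0.
Proof. by case/imsetP=> k _ ->; rewrite expf_neq0 // gamma_neq0. Qed.

Lemma mem_some_cyc_class (b : F) : b != 0 -> exists a : 'I_N, b \in C a.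
Proof.
case/primitive_log=> m ->; exists (Ordinal (ltn_pmod m N_gt0)).
rewrite mem_cyc_class ?ltn_pmod //= -exprM (eq_prim_root_expr gamma_prim).
by rewrite !modn_mul_exponent modn_mod.
Qed.

Lemma mem_cyc_classM (i : nat) (b x : F) :
  (i < N)%N -> b \in C i -> (b * x \in C i) = (x \in C 0).
Proof.
move=> iN; rewrite mem_cyc_class0 !mem_cyc_class // exprMn => /eqP ->.
by rewrite -subr_eq0 -{2}[gamma ^+ _]mulr1 -mulrBr mulf_eq0 subr_eq0
  expf_eq0 (negPf gamma_neq0) andbF.
Qed.

Lemma sum_cyc_class (i : nat) (b : F) (g : F -> algC) :
  (i < N)%N -> b \in C i -> \sum_(x in C i) g x = \sum_(x in C 0) g (b * x).
Proof.
move=> iN bi; rewrite (reindex_inj (mulfI (cyc_class_neq0 bi))).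
by apply: eq_bigl => x; rewrite mem_cyc_classM.
Qed.

Lemma gauss_periodE (a : 'I_N) (b : F) :
  b \in C a -> gauss_period gamma N a = cyc_period b.
Proof. by move=> ba; apply: sum_cyc_class. Qed.

Lemma mem_period_union (alpha : rat) (b : F) :
  (b \in period_union gamma N alpha) = (b != 0) && (cyc_period b == ratr alpha).
Proof.
apply/bigcupP/andP => [[a] | [b0 bE]].
  by rewrite inE => aE ba; rewrite -(gauss_periodE ba) (cyc_class_neq0 ba).
have [a ba] := mem_some_cyc_class b0; exists a => //.
by rewrite inE (gauss_periodE ba).
Qed.

Hypothesis N1_cyc : -1 \in C 0.

Lemma cyc_class0N (x : F) : (- x \in C 0) = (x \in C 0).
Proof. by rewrite -mulN1r mem_cyc_classM. Qed.

Lemma cyc_periodN (b : F) : cyc_period (- b) = cyc_period b.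
Proof.
rewrite /cyc_period (reindex_inj oppr_inj); apply: eq_big => x.
  exact: cyc_class0N.
by rewrite mulrNN.
Qed.

Lemma psi_pairing_char (w b : F) : additive_char (fun x => psi (w * b * x)).
Proof.
have [psi0 psiD] := psi_additive_char F.
by split=> [|x y]; rewrite ?mulr0 // mulrDr psiD.
Qed.

Lemma psi_pairing_nondeg (w b : F) :
  w != 0 -> b != 0 -> exists x, psi (w * b * x) != 1.
Proof.
move=> w0 b0; have [x Px] := psi_nontrivial F; exists ((w * b)^-1 * x).
by rewrite mulrA divff ?mul1r // mulf_neq0.
Qed.

Lemma sum_psiM (c : F) : \sum_x psi (c * x) = if c == 0 then #|F|%:R else 0.
Proof.
rewrite -(@pairing_sum _ (fun b x => psi (1 * b * x))) => [|x y|b|b b0].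
- by under [RHS]eq_bigr do rewrite mul1r.
- by rewrite !mul1r mulrC.
- exact: psi_pairing_char.
- by apply: psi_pairing_nondeg; rewrite ?oner_eq0.
Qed.

(** After exchanging the sums, orthogonality keeps only [x = - c], and [- c] lies in [C 0] exactly
    when [c] does, since -1 does. *)
Lemma sum_cyc_period_psi (c : F) :
  \sum_y cyc_period y * psi (c * y) = if c \in C 0 then #|F|%:R else 0.
Proof.
transitivity (\sum_(x in C 0) \sum_y psi ((x + c) * y)).
  rewrite exchange_big; apply: eq_bigr => y _.
  rewrite mulr_suml; apply: eq_bigr => x _.
  by rewrite -(psi_additive_char F).2 mulrDl [y * x]mulrC.
under eq_bigr do rewrite sum_psiM addr_eq0.
rewrite -big_mkcondr -cyc_class0N; case: ifP => cC; last first.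
  by rewrite big1 // => x /andP[xC /eqP xc]; rewrite -xc xC in cC.
rewrite (big_pred1 (- c)) // => x /=.
by case: eqVneq => [-> | _]; rewrite ?cC ?andbF.
Qed.

Definition union_sum (alpha : rat) (c : F) : algC :=
  \sum_(x in period_union gamma N alpha) psi (c * x).

(** * Dual classes when one value, [b0], is taken by a single period *)

Section SingletonClass.
Variables b0 b1 b2 : rat.
Hypotheses (b01 : b0 != b1) (b02 : b0 != b2) (b12 : b1 != b2).
Hypothesis periods : forall a : 'I_N,
  gauss_period gamma N a \in [:: ratr b0; ratr b1; ratr b2].
Hypothesis single : #|period_index_set gamma N b0| = 1%N.

Lemma sum_period_unions (g : F -> algC) :
  \sum_(y | y != 0) g y = \sum_(y in period_union gamma N b0) g y +
    \sum_(y in period_union gamma N b1) g y +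
    \sum_(y in period_union gamma N b2) g y.
Proof.
rewrite [LHS]big_mkcond !(big_mkcond (fun y => y \in _)) -!big_split /=.
apply: eq_bigr => y _.
rewrite !mem_period_union; have [_ | y0] := eqVneq; first by rewrite !addr0.
have [a ya] := mem_some_cyc_class y0.
have := periods a; rewrite (gauss_periodE ya) !inE.
by case/or3P=> /eqP ->; rewrite !(inj_eq (fmorph_inj _)) ?eqxx
  ?(negPf b01) ?(negPf b02) ?(negPf b12) ?[b1 == b0]eq_sym ?[b2 == _]eq_sym
  ?(negPf b01) ?(negPf b02) ?(negPf b12) ?addr0 ?add0r.
Qed.

Lemma union_sum_total (c : F) :
  union_sum b0 c + union_sum b1 c + union_sum b2 c =
  (if c == 0 then #|F|%:R else 0) - 1.
Proof.
rewrite -sum_period_unions -sum_psiM [X in _ = X - _](bigD1 0) //=.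
by rewrite mulr0 (psi_additive_char F).1 [RHS]addrAC subrr add0r.
Qed.

(** On each union the weight is the value of [cyc_period], so the left-hand side is the Fourier
    transform of the periods without its term at 0. *)
Lemma union_sum_weighted (c : F) :
  ratr b0 * union_sum b0 c + ratr b1 * union_sum b1 c + ratr b2 * union_sum b2 c =
  (if c \in C 0 then #|F|%:R else 0) - #|C 0|%:R.
Proof.
rewrite -sum_cyc_period_psi [X in _ = X - _](bigD1 0) //= mulr0.
have -> : cyc_period 0 = #|C 0|%:R.
  rewrite /cyc_period; under eq_bigr do rewrite mul0r (psi_additive_char F).1.
  by rewrite sumr_const.
rewrite (psi_additive_char F).1 mulr1 [RHS]addrAC subrr add0r sum_period_unions.
by congr (_ + _ + _); rewrite mulr_sumr; apply: eq_bigr => y;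
  rewrite mem_period_union => /andP[_ /eqP ->].
Qed.

Lemma dual_classes_singleton : exists2 w : F, w != 0 & forall b b' : F,
  (b == 0) = (b' == 0) /\ (b != 0 -> cyc_period b = cyc_period b') <->
  [/\ union_sum b0 (w * b) = union_sum b0 (w * b'),
      union_sum b1 (w * b) = union_sum b1 (w * b') &
      union_sum b2 (w * b) = union_sum b2 (w * b')].
Proof.
have /cards1P[i0 I0] : #|period_index_set gamma N b0| == 1%N by rewrite single.
have U0 : period_union gamma N b0 = C i0 by rewrite /period_union I0 big_set1.
have gC : gamma ^+ i0 \in C i0.
  by rewrite mem_cyc_class // -exprM.
have g0 := cyc_class_neq0 gC.
exists (gamma ^+ i0)^-1; first by rewrite invr_eq0.
set w := (gamma ^+ i0)^-1 => b b'.
have wb_eq0 c : (w * c == 0) = (c == 0).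
  by rewrite mulf_eq0 invr_eq0 (negPf g0).
have sum0 c : union_sum b0 (w * c) = cyc_period c.
  rewrite /union_sum U0 (sum_cyc_class _ _ gC) //; apply: eq_bigr => x _.
  by rewrite mulrA [w * c]mulrC mulfVK.
(* The class of [b0] is the single coset [C i0], which [w] moves to [C 0]; hence the indicator in
   the weighted relation is a function of the period. *)
have mem0 c : c != 0 -> (w * c \in C 0) = (cyc_period c == ratr b0).
  move=> c0; have := mem_period_union b0 c; rewrite c0 /= => <-.
  by rewrite U0 -(mem_cyc_classM _ _ gC) // mulrA divff ?mul1r.
have sum2 c : union_sum b2 (w * c) = (if c == 0 then #|F|%:R else 0) - 1
    - cyc_period c - union_sum b1 (w * c).
  by rewrite -wb_eq0 -union_sum_total sum0; ring.
(* Eliminate the sum over the class of [b2] between the two linear relations; the factor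
   [ratr b1 - ratr b2] is invertible. *)
have sum1 c : c != 0 -> (ratr b1 - ratr b2) * union_sum b1 (w * c) =
    (if cyc_period c == ratr b0 then #|F|%:R else 0) - #|C 0|%:R + ratr b2
    - (ratr b0 - ratr b2) * cyc_period c.
  move=> c0; rewrite -mem0 // -union_sum_weighted sum2 (negPf c0) sum0; ring.
split=> [[b00 bb'] | [eq0 eq1 eq2]].
  have [b_0 | bn0] := eqVneq b 0.
    by move: b00; rewrite b_0 eqxx => /esym/eqP ->.
  have b'n0 : b' != 0 by rewrite -b00.
  have eq1 : union_sum b1 (w * b) = union_sum b1 (w * b').
    apply: (@mulfI _ (ratr b1 - ratr b2)).
      by rewrite subr_eq0 (inj_eq (fmorph_inj _)).
    by rewrite !sum1 // bb'.
  by rewrite !sum2 !sum0 eq1 b00 bb'.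
split; last by rewrite -!sum0.
(* The three sums together detect zero: their total at 0 exceeds the total elsewhere by [#|F|]. *)
have := union_sum_total (w * b); rewrite eq0 eq1 eq2 union_sum_total !wb_eq0.
move/addIr; have := card_neq0 F.
case: (b == 0); case: (b' == 0) => // /eqP n0 q0; case: n0.
  exact: esym q0.
exact: q0.
Qed.

End SingletonClass.
End GaussPeriods.

Unset Implicit Arguments.

(** * Self-duality of the three-class scheme *)

Theorem theorem2p7 (F : finFieldType) (N : nat) (gamma : F)
  (hN : (2 < N)%N) (hdiv : (N %| #|F|.-1)%N)
  (hprim : (#|F|.-1).-primitive_root gamma)
  (hneg : -1 \in cyc_class gamma N 0)
  (a1 a2 a3 t u v : rat)
  (ht : 0 < t)
  (h12 : a1 - a2 = - (t * u)) (h12neg : - (t * u) < 0)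
  (h32 : a3 - a2 = t * v) (h32pos : 0 < t * v)
  (hvals : forall a : 'I_N, gauss_period gamma N a \in [:: ratr a1; ratr a2; ratr a3])
  (hat1 : exists a : 'I_N, gauss_period gamma N a = ratr a1)
  (hat2 : exists a : 'I_N, gauss_period gamma N a = ratr a2)
  (hat3 : exists a : 'I_N, gauss_period gamma N a = ratr a3)
  (hcard : #|period_index_set gamma N a1| = 1%N \/ #|period_index_set gamma N a3| = 1%N) :
  is_assoc_scheme (translation_rel (gp_partition gamma N a1 a2 a3)) /\
  self_dual_translation (gp_partition gamma N a1 a2 a3).
Proof.
have N_gt0 : (0 < N)%N by apply: ltn_trans hN.
have a12 : a1 < a2 by rewrite -subr_lt0 h12.
have a23 : a2 < a3 by rewrite -subr_gt0 h32.
have a13 := lt_trans a12 a23.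
have memU := mem_period_union N_gt0 hdiv hprim.
have U_neq0 (a : rat) : (exists i : 'I_N, gauss_period gamma N i = ratr a) ->
    exists x, x \in period_union gamma N a.
  case=> i iE; exists (gamma ^+ i).
  have gi : gamma ^+ i \in cyc_class gamma N i.
    by rewrite (mem_cyc_class N_gt0 hdiv hprim) // -exprM.
  by apply/bigcupP; exists i; rewrite // inE iE.
pose eta := cyc_period N gamma.
(* The period at 0 could coincide with one of the three values, so zero is tested first; the final
   branch can only mean [a3], by [etaP]. *)
pose cls (b : F) : 'I_4 := if b == 0 then ord0 else
  if eta b == ratr a1 then @Ordinal 4 1 isT else
  if eta b == ratr a2 then @Ordinal 4 2 isT else @Ordinal 4 3 isT.
have etaP b : b != 0 -> [\/ eta b = ratr a1, eta b = ratr a2 | eta b = ratr a3].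
  case/(mem_some_cyc_class N_gt0 hdiv hprim) => a ba; have := hvals a.
  rewrite (gauss_periodE N_gt0 hdiv hprim ba) !inE.
  by case/or3P=> /eqP; [constructor 1 | constructor 2 | constructor 3].
have ratrE := inj_eq (fmorph_inj (@ratr algC)).
have neqs : ((a2 == a1) = false) * ((a3 == a1) = false) * ((a3 == a2) = false) *
    ((a1 == a2) = false) * ((a1 == a3) = false) * ((a2 == a3) = false).
  by rewrite !(gt_eqF a12, gt_eqF a13, gt_eqF a23, lt_eqF a12, lt_eqF a13, lt_eqF a23).
have DE i x : (x \in gp_partition gamma N a1 a2 a3 i) = (cls x == i).
  rewrite /cls /gp_partition; case: i => [[|[|[|[|//]]]] i4] /=;
    rewrite ?memU -/(eta x) ?inE;
    have [_ | x0] //= := eqVneq x 0; rewrite -?val_eqE /=;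
    by case: (etaP x x0) => ->; rewrite !ratrE ?eqxx ?neqs.
have clsP b b' : cls b = cls b' <-> 
    (b == 0) = (b' == 0) /\ (b != 0 -> eta b = eta b').
  split=> [bb' | [b00 bb']]; last first.
    by rewrite /cls -b00; case: eqVneq bb' => // _ ->.
  have b00 : (b == 0) = (b' == 0).
    have := DE ord0 b; rewrite bb' -DE !inE; exact.
  split=> // b0; have b'0 : b' != 0 by rewrite -b00.
  move: bb'; rewrite /cls (negPf b0) (negPf b'0).
  by case: (etaP b b0) => ->; case: (etaP b' b'0) => ->; rewrite !ratrE ?eqxx ?neqs.
(* Both cases now differ only in the twist [w]. The pairing is [psi (w * b * x)], and its sums over
   the nonzero classes are the values of [union_sum] at [w * b]. *)
suff [w w0 wP] : exists2 w : F, w != 0 & forall b b' : F,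
    (b == 0) = (b' == 0) /\ (b != 0 -> eta b = eta b') <->
    [/\ union_sum N gamma a1 (w * b) = union_sum N gamma a1 (w * b'),
        union_sum N gamma a2 (w * b) = union_sum N gamma a2 (w * b') &
        union_sum N gamma a3 (w * b) = union_sum N gamma a3 (w * b')].
  apply: (@pairing_scheme_self_dual _ (fun b x => psi (w * b * x)) _ _ _ _ _ cls).
  - by move=> x y; rewrite mulrAC.
  - exact: psi_pairing_char.
  - by move=> b; apply: psi_pairing_nondeg.
  - exact: DE.
  - case=> [[|[|[|[|//]]]] i4].
    + by exists 0; apply/eqP; rewrite -DE inE.
    + by have [x xU] := U_neq0 a1 hat1; exists x; apply/eqP; rewrite -DE.
    + by have [x xU] := U_neq0 a2 hat2; exists x; apply/eqP; rewrite -DE.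
    + by have [x xU] := U_neq0 a3 hat3; exists x; apply/eqP; rewrite -DE.
  - by move=> x; rewrite -DE inE.
  - by move=> x; rewrite /cls oppr_eq0 /eta (cyc_periodN N_gt0 hdiv hprim).
  move=> b b'; rewrite clsP wP; split=> [[e1 e2 e3] | e].
    case=> [[|[|[|[|//]]]] i4] //=.
    (* On the class of 0 every character sums to [psi 0]. *)
    by rewrite !big_set1 !mulr0.
  by split; [exact: (e (@Ordinal 4 1 isT)) | exact: (e (@Ordinal 4 2 isT)) |
             exact: (e (@Ordinal 4 3 isT))].
case: hcard => single.
  apply: (dual_classes_singleton N_gt0 hdiv hprim hneg) => //; by rewrite neqs.
(* The singleton lemma treats its other two values alike, so [a3] takes the place of [b0], and only
   the order of the three equalities changes. *)
have [||||w w0 wP] := @dual_classes_singleton F N gamma N_gt0 hdiv hprim hneg a3 a2 a1 _ _ _ _ single.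
- by rewrite neqs.
- by rewrite neqs.
- by rewrite neqs.
- by move=> a; have := hvals a; rewrite !inE => /or3P[] ->; rewrite ?orbT.
by exists w => // b b'; rewrite wP; split; case.
Qed.
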